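(* For any set $\mathcal{X}$ and any nonempty finite partial concept class $\mathcal{C}\subseteq\{\pm1,\star\}^{\mathcal{X}}$, $$\mathrm{H}(\mathcal{C})=\operatorname{Edim}(\mathcal{C})+1.$$
   Context: A partial concept class is a set $\mathcal{C}\subseteq\{\pm1,\star\}^{\mathcal{X}}$, where $\star$ means undefined. Height. For $h_1,h_2\in\{\pm1,\star\}^{\mathcal{X}}$ their junction $h_1\cap h_2$ is defined by $(h_1\cap h_2)(x)=h_1(x)$ if $h_1(x)=h_2(x)$ and $(h_1\cap h_2)(x)=\star$ otherwise. Write $g\preceq h$ if $g=g\cap h$, and $g\prec h$ if $g\preceq h$ and $g\ne h$. The junction closure of $\mathcal{C}$ is $\mathcal{J}(\mathcal{C})=\{\bigcap_{c\in S}c:\emptyset\ne S\subseteq\mathcal{C}\}$. The height $\mathrm{H}(\mathcal{C})$ is the largest $m$ for which there is a strict chain $h_1\prec h_2\prec\cdots\prec h_m$ of elements of $\mathcal{J}(\mathcal{C})$. Eluder dimension. For $c'\in\mathcal{C}$ let $\operatorname{supp}(c')=\{x\in\mathcal{X}:c'(x)\ne\star\}$. $\operatorname{Edim}(\mathcal{C},c')$ is the largest $m\ge0$ for which there exist points $x_1,\dots,x_m\in\operatorname{supp}(c')$ and concepts $c_1,\dots,c_m\in\mathcal{C}$ such that for every $i\in[m]$: $c_i(x_i)\ne c'(x_i)$ (with $c_i(x_i)=\star$ allowed), and $c_i(x_j)=c'(x_j)$ for every $j<i$. Then $\operatorname{Edim}(\mathcal{C})=\sup_{c'\in\mathcal{C}}\operatorname{Edim}(\mathcal{C},c')$.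 *)

(* Defs.v *)
From mathcomp Require Import all_boot all_order.
From mathcomp Require Import boolp classical_sets functions cardinality.

Set Implicit Arguments.
Unset Strict Implicit.
Unset Printing Implicit Defensive.

Local Open Scope classical_set_scope.

(* [Some true] is +1, [Some false] is -1 and [None] is the undefined value. *)
Definition concept (X : Type) : Type := X -> option bool.

Definition supp (X : Type) (h : concept X) : set X := [set x | h x <> None].

Definition junction (X : Type) (h1 h2 : concept X) : concept X :=
  fun x => if h1 x == h2 x then h1 x else None.

(* The junction of all members of a nonempty, possibly infinite, family S: at x
   it is the value shared by all members of S if there is one, and None
   otherwise.  See [bigjunction1] and [bigjunctionU1] for the agreement with
   the iterated binary junction.  The value for S = set0 is irrelevant. *)
Definition bigjunction (X : Type) (S : set (concept X)) : concept X :=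
  fun x => xget None [set v | forall c, S c -> c x = v].

Definition preceq (X : Type) (g h : concept X) : Prop := g = junction g h.

Definition prec (X : Type) (g h : concept X) : Prop := preceq g h /\ g <> h.

Definition junction_closure (X : Type) (C : set (concept X)) :
    set (concept X) :=
  [set bigjunction S | S in [set S | S !=set0 /\ S `<=` C]].

Definition has_chain (X : Type) (C : set (concept X)) (m : nat) : Prop :=
  exists h : 'I_m -> concept X,
    (forall i, junction_closure C (h i)) /\
    (forall i j : 'I_m, j = i.+1 :> nat -> prec (h i) (h j)).

Definition has_eluder (X : Type) (C : set (concept X)) (c' : concept X)
    (m : nat) : Prop :=
  exists (x : 'I_m -> X) (c : 'I_m -> concept X),
    (forall i, supp c' (x i)) /\
    (forall i, C (c i)) /\
    (forall i, c i (x i) <> c' (x i) /\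
               forall j : 'I_m, (j < i)%N -> c i (x j) = c' (x j)).

Definition is_largest (A : set nat) (m : nat) : Prop := A m /\ ubound A m.

(* [is_height C m], [is_edim_at C c' m] and [is_edim C d] mean that the
   dimension in question exists, as a natural number, and has the given value.
   They are relations because these quantities can be infinite for infinite C.
*)
Definition is_height (X : Type) (C : set (concept X)) (m : nat) : Prop :=
  is_largest (has_chain C) m.

Definition is_edim_at (X : Type) (C : set (concept X)) (c' : concept X)
    (m : nat) : Prop :=
  is_largest (has_eluder C c') m.

Definition is_edim (X : Type) (C : set (concept X)) (d : nat) : Prop :=
  exists e : concept X -> nat,
    (forall c', C c' -> is_edim_at C c' (e c')) /\ supremums (e @` C) d.

Lemma bigjunction1 (X : Type) (c : concept X) : bigjunction [set c] = c.
Proof.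
apply/funext => x; rewrite /bigjunction; case: xgetP => [v _ Pv|nP].
  by rewrite -(Pv c).
by case: (nP (c x)) => _ ->.
Qed.

Lemma bigjunctionU1 (X : Type) (c : concept X) (S : set (concept X)) :
  S !=set0 -> bigjunction (c |` S) = junction c (bigjunction S).
Proof.
move=> [s Ss]; apply/funext => x; rewrite /junction /bigjunction.
case: xgetP => [v _ Pv|nP].
  rewrite (Pv c (or_introl erefl)).
  case: xgetP => [w _ Pw|/(_ v)]; last first.
    by case=> d Sd; apply: Pv; right.
  by rewrite -(Pw s Ss) (Pv s (or_intror Ss)) eqxx.
case: xgetP => [w _ Pw|_]; last by case: eqP.
case: eqP => // cw; case: (nP (c x)) => d [-> //|Sd].
by rewrite (Pw d Sd) cw.
Qed.

(* Main.v *)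
Require Import Defs.
From mathcomp Require Import all_boot all_order.
From mathcomp Require Import boolp classical_sets functions cardinality.

Local Open Scope classical_set_scope.

(** A chain [h_1 < ... < h_m] yields an eluder sequence of length [m - 1] for
    any concept [c'] above [h_m]: take for [x_i] a point at which [h_i] is
    undefined and [h_(i+1)] is not, and for [c_i] a member of the family
    defining [h_i] that differs from [c'] at [x_i].  Conversely, given an eluder
    sequence, the junctions of the version spaces
    [{c | c agrees with c' on x_1, ..., x_(i-1)}] form a chain with one more
    element.  The concepts of an eluder sequence are distinct, so finiteness of
    the class bounds all these lengths. *)

Lemma preceqP (X : Type) (g h : concept X) :
  preceq g h <-> forall x v, g x = Some v -> h x = Some v.
Proof.
split=> [gh x v gx|gh].
  move: (gx); rewrite gh /junction gx.
  by case: eqP => // <-.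
apply/funext => x; rewrite /junction; case: eqP => // ne.
case gx: (g x) => [v|//]; case: ne.
by rewrite gx (gh x v gx).
Qed.

(** Only defined values are covered, since [None] arises both from disagreement and from a common
    [None]. For empty [S] every value is vacuously shared, so [xget] could return anything. *)
Lemma bigjunction_SomeP (X : Type) (S : set (concept X)) (x : X) (v : bool) :
  S !=set0 ->
  bigjunction S x = Some v <-> forall c, S c -> c x = Some v.
Proof.
move=> [s Ss]; rewrite /bigjunction; case: xgetP => [w _ Pw|nP].
  split=> [<- //|Pv]; first by rewrite -(Pw s Ss); exact: Pv.
split=> // Pv; by case: (nP (Some v)).
Qed.

Lemma bigjunctionS (X : Type) (S T : set (concept X)) :
  T !=set0 -> T `<=` S -> preceq (bigjunction S) (bigjunction T).
Proof.
move=> T0 TS; have S0 : S !=set0 by case: T0 => t /TS; exists t.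
apply/preceqP => x v /(bigjunction_SomeP _ _ _ _ S0) Sv.
by apply/bigjunction_SomeP => // c /TS /Sv.
Qed.

Lemma prec_witness (X : Type) (g h : concept X) :
  prec g h -> exists x v, g x = None /\ h x = Some v.
Proof.
move=> [/preceqP gh ne]; apply: contrapT => nex; apply: ne.
apply/funext => x; case gx: (g x) => [v|]; first by rewrite (gh _ _ gx).
case hx: (h x) => [v|//]; by case: nex; exists x, v.
Qed.

Lemma chain_preceq (X : Type) (m : nat) (h : 'I_m -> concept X) :
  (forall i j : 'I_m, j = i.+1 :> nat -> prec (h i) (h j)) ->
  forall i j : 'I_m, i <= j -> preceq (h i) (h j).
Proof.
move=> hS i [j jm] /=; elim: j jm => [|j IH] jm.
  rewrite leqn0 => /eqP i0; have -> : i = Ordinal jm by apply: val_inj.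
  exact/preceqP.
rewrite leq_eqVlt => /orP[/eqP ij|ij].
  have -> : i = Ordinal jm by apply: val_inj.
  exact/preceqP.
have /preceqP ihj := IH (ltnW jm) ij.
have [/preceqP jS _] := hS (Ordinal (ltnW jm)) (Ordinal jm) erefl.
by apply/preceqP => x v /ihj /jS.
Qed.

Lemma chain_eluder (X : Type) (C : set (concept X)) (k : nat) :
  has_chain C k.+1 -> exists2 c', C c' & has_eluder C c' k.
Proof.
move=> [h [hJ hS]]; have hmono := chain_preceq _ _ _ hS.
(* Any member of a family whose junction is the top of the chain lies above the whole chain. *)
have [S [[c' Sc'] SC] hmax] := hJ ord_max.
have hc' i x v : h i x = Some v -> c' x = Some v.
  move=> hix; have /preceqP hi := hmono i ord_max (leq_ord i).
  by move: (hi x v hix); rewrite -hmax => /bigjunction_SomeP; apply => //; exists c'.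
exists c'; first exact: SC.
pose lo (i : 'I_k) : 'I_k.+1 := widen_ord (leqnSn k) i.
pose hi (i : 'I_k) : 'I_k.+1 := lift ord0 i.
(* The last clause yields the agreement on earlier points: for [j < i] the value at the [j]-th point
   is already defined in [h (hi j)], which is below [h (lo i)] because [j.+1 <= i], hence passes to
   both [c'] and the [i]-th concept. *)
have /choice[xc xcP] (i : 'I_k) : exists p : X * concept X,
    [/\ C p.2, h (hi i) p.1 <> None, p.2 p.1 <> c' p.1
      & preceq (h (lo i)) p.2].
  have [x [v [lox hix]]] := prec_witness _ _ _ (hS (lo i) (hi i) erefl).
  have [T [T0 TC] hT] := hJ (lo i).
  have [c Tc ne] : exists2 c, T c & c x <> Some v.
    apply: contrapT => nex; suff : bigjunction T x = Some v by rewrite hT lox.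
    apply/bigjunction_SomeP => // c Tc.
    by apply: contrapT => ne; apply: nex; exists c.
  exists (x, c); split => /=; first exact: TC.
  - by rewrite hix.
  - by rewrite (hc' _ _ _ hix).
  - apply/preceqP => y w; rewrite -hT => /bigjunction_SomeP.
    by apply.
exists (fun i => (xc i).1), (fun i => (xc i).2); split; [|split] => i.
- have [_ + _ _] := xcP i; rewrite /supp /=.
  by case E: (h _ _) => [v|//] _; rewrite (hc' _ _ _ E).
- by have [] := xcP i.
- have [_ _ ne /preceqP loi] := xcP i; split=> // j ji.
  have [_ + _ _] := xcP j; case E: (h _ _) => [v|//] _.
  have /preceqP ji' : preceq (h (hi j)) (h (lo i)) by apply: hmono.
  by rewrite (hc' _ _ _ E); apply/loi/ji'.
Qed.

Lemma eluder_chain (X : Type) (C : set (concept X)) (c' : concept X) (d : nat) :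
  C c' -> has_eluder C c' d -> has_chain C d.+1.
Proof.
move=> Cc' [x [c [xs [cC cP]]]].
(* These version spaces shrink as [n] grows, so their junctions increase; [c'] keeps all of them
   nonempty. *)
pose S n := [set g | C g /\ forall j : 'I_d, j < n -> g (x j) = c' (x j)].
have S0 n : S n !=set0 by exists c'.
exists (fun i => bigjunction (S i)); split=> [i|i j ji].
  by exists (S i) => //; split=> // g [].
split.
  apply: bigjunctionS => // g [Cg gj]; split=> // l li.
  by apply: gj; rewrite ji ltnS ltnW.
(* As [i] has a successor among the [d.+1] indices, the point [x l] exists. It witnesses strictness:
   all of [S j] agrees with [c'] there, but [c l], which lies in [S i], does not. *)
have id : i < d by rewrite -ltnS -ji.
pose l := Ordinal id.
case E: (c' (x l)) => [v|]; last by case: (xs l).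
move=> /(congr1 (@^~ (x l))) eS.
have Sj : bigjunction (S j) (x l) = Some v.
  apply/bigjunction_SomeP => // g [_ gj].
  by rewrite -E; apply: gj; rewrite ji.
move: Sj; rewrite -eS => /(bigjunction_SomeP _ _ _ _ (S0 i))/(_ (c l)) cl.
have [ne eq] := cP l; apply: ne; rewrite E; apply: cl.
by split.
Qed.

Lemma eluder_bounded (X : Type) (C : set (concept X)) :
  finite_set C -> exists N, forall c' m, has_eluder C c' m -> m <= N.
Proof.
move=> /finite_seqP[s Cs]; exists (size s) => c' m [x [c [_ [cC cP]]]].
(* The point [x i] separates the two: the later concept agrees with [c'] there and the earlier one
   does not. *)
have c_lt (i k : 'I_m) : i < k -> c i <> c k.
  move=> ik eq; have [ne _] := cP i; have [_ /(_ i ik) e] := cP k.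
  by apply: ne; rewrite eq.
have c_inj : injective c.
  move=> i k eq; apply: val_inj => /=.
  by case: (ltngtP i k) => // /c_lt; rewrite eq.
rewrite -[m]size_enum_ord -(size_map c).
apply: uniq_leq_size; first by rewrite map_inj_uniq ?enum_uniq.
by move=> _ /mapP[i _ ->]; have := cC i; rewrite Cs.
Qed.

Lemma largest_exists (A : set nat) (N : nat) :
  A !=set0 -> ubound A N -> exists m, is_largest A m.
Proof.
move=> [a Aa] AN.
have exA : exists n, `[< A n >] by exists a; apply/asboolP.
have bA n : `[< A n >] -> n <= N by move=> /asboolP/AN.
case: (ex_maxnP exA bA) => m /asboolP Am mmax; exists m; split=> // n An.
by apply: mmax; apply/asboolP.
Qed.

Theorem proposition1p4 (X : Type) (C : set (concept X))
    (C_finite : finite_set C) (C_nonempty : C !=set0) :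
  exists h d : nat, is_height C h /\ is_edim C d /\ h = (d + 1)%N.
Proof.
have [N elN] := eluder_bounded _ _ C_finite.
(* [X] may be empty, so the empty sequence is built by eliminating [False]. *)
have el0 c' : has_eluder C c' 0.
  have no (i : 'I_0) : False by case: i.
  exists (fun i => False_rect _ (no i)), (fun i => False_rect _ (no i)).
  by do ?split => [[]].
have /choice[e eP] c' : exists m, is_edim_at C c' m.
  by apply: (largest_exists _ N); [exists 0|move=> m /elN].
(* The bound [N] is uniform in [c'], so one maximum over all of [C] exists and is attained at some
   [c0]. *)
have [d [[c0 Cc0 c0d] dmax]] :
    exists d, is_largest [set m | exists2 c', C c' & has_eluder C c' m] d.
  apply: (largest_exists _ N); last by move=> m [c' _ /elN].
  by case: C_nonempty => c' Cc'; exists 0, c'.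
exists d.+1, d; rewrite addn1; split; [split|split=> //].
- exact: eluder_chain c0d.
- by case=> [//|k] /chain_eluder/dmax.
exists e; split=> [c' _|]; first exact: eP.
split.
  by move=> _ [c' Cc' <-]; apply: dmax; exists c' => //; have [] := eP c'.
(* Any upper bound [b] dominates [e c0], which is at least [d]. *)
move=> b; move/(_ (e c0)) => be; apply: (@Order.le_trans _ _ (e c0)).
  by have [_] := eP c0; apply.
by apply: be; exists c0.
Qed.
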